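(* Let $q=p^n$ with $p$ prime, let $m\ge 1$, and let $r=t(q-1)+s$ with integers $t\ge 0$ and $0\le s\le q-2$, such that $r<m(q-1)$. Let $f\in R_q(r,m)$ be a nonzero codeword of minimal weight, i.e. $|f|=(q-s)q^{m-t-1}$. Then the support $S_f$ is the union of $q-s$ distinct, pairwise parallel affine subspaces of $\mathbb{F}_q^m$ of codimension $t+1$, all contained in a single affine subspace of $\mathbb{F}_q^m$ of codimension $t$. (Conversely, every codeword of $R_q(r,m)$ whose support has this form has minimal weight.)
   Context: $B_m^q=\mathbb{F}_q[X_1,\dots,X_m]/(X_1^q-X_1,\dots,X_m^q-X_m)$ is identified with the algebra of functions $\mathbb{F}_q^m\to\mathbb{F}_q$ via $P\mapsto(x\mapsto P(x))$. For $f\in B_m^q$, $S_f=\{x\in\mathbb{F}_q^m : f(x)\ne 0\}$ is its support and $|f|=\mathrm{Card}(S_f)$ its weight. The degree $\deg(P)$ of $P\in B_m^q$ is the total degree of its unique representative of degree at most $q-1$ in each variable. For $0\le r\le m(q-1)$, the generalized Reed–Muller code is $R_q(r,m)=\{P\in B_m^q : \deg(P)\le r\}$. For $r=t(q-1)+s$ with $0\le s\le q-2$ and $r<m(q-1)$, the minimum weight of a nonzero codeword of $R_q(r,m)$ is $(q-s)q^{m-t-1}$. *)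

(* Defs.v *)
From HB Require Import structures.
From mathcomp Require Import all_boot all_order all_algebra all_field.
Set Implicit Arguments. Unset Strict Implicit. Unset Printing Implicit Defensive.
Import GRing.Theory.
Local Open Scope ring_scope.

Definition expvec (F : finFieldType) (m : nat) := {ffun 'I_m -> 'I_#|F|}.

Definition monom (F : finFieldType) (m : nat) (e : expvec F m) (x : 'rV[F]_m) : F :=
  \prod_(i < m) (x 0 i) ^+ (e i).

(* f : F^m -> F lies in the generalized Reed-Muller code R_q(r,m): its (unique)
   representative with degree <= q-1 in each variable has total degree <= r. *)
Definition in_RM (F : finFieldType) (m r : nat) (f : 'rV[F]_m -> F) : Prop :=
  exists c : expvec F m -> F,
    (forall e, c e != 0 -> (\sum_(i < m) (e i : nat) <= r)%N) /\
    (forall x, f x = \sum_(e : expvec F m) c e * monom e x).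

Definition supp (F : finFieldType) (m : nat) (f : 'rV[F]_m -> F) : {set 'rV[F]_m} :=
  [set x | f x != 0].

Definition weight (F : finFieldType) (m : nat) (f : 'rV[F]_m -> F) : nat :=
  #|supp f|.

Definition affine (F : finFieldType) (m : nat) (a : 'rV[F]_m) (V : 'M[F]_m)
  : {set 'rV[F]_m} := [set x : 'rV[F]_m | ((x - a) <= V)%MS].

Definition flat_union_shape (F : finFieldType) (m t k : nat) (S : {set 'rV[F]_m}) : Prop :=
  exists (V W : 'M[F]_m) (b : 'rV[F]_m) (a : 'I_k -> 'rV[F]_m),
    [/\ \rank V = (m - t.+1)%N, \rank W = (m - t)%N,
        (forall i j, i != j -> affine (a i) V != affine (a j) V),
        (forall i, affine (a i) V \subset affine b W) &
        S = \bigcup_(i < k) affine (a i) V].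

(* Main.v *)
(* Write S for the support of f and fix a linear form u taking j values on S.
   Dividing f by the factors u - l, for the q - j values l not taken, lowers its
   degree on every hyperplane u = l' by q - j.  By induction on the dimension,
   this bounds from below the weights of the sections of f, and hence |S|.  If
   |S| is minimal, then all these bounds are equalities, j is 1, q - s or q, and
   the sections are again words of minimal weight.
   If t > 0 and no hyperplane contains S, then by induction the sections lie in
   flats, and a hyperplane meeting S most often contains S after all; so S lies
   in a hyperplane, where t drops by one.
   If t = 0 and j = q - s for some u, then S is a union of parallel hyperplanes.
   Otherwise all hyperplanes meet S equally often and S contains a flat L of
   codimension 2; counting S along the q + 1 hyperplanes through L shows that
   these sections are too large. *)
Require Import Defs.
From HB Require Import structures.
From mathcomp Require Import all_boot all_order all_algebra all_field.
From mathcomp Require Import zify ring.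
Set Implicit Arguments.
Unset Strict Implicit.
Unset Printing Implicit Defensive.
Import GRing.Theory.
Local Open Scope ring_scope.

Section Degree.
Variable R : comNzRingType.

Definition linform m (u : 'cV[R]_m) (x : 'rV[R]_m) : R := (x *m u) 0 0.

Fact linform_is_scalar m (u : 'cV[R]_m) : scalar (linform u).
Proof. by move=> a x y; rewrite /linform mulmxDl -scalemxAl !mxE. Qed.

HB.instance Definition _ m (u : 'cV[R]_m) :=
  GRing.isLinear.Build R 'rV[R]_m R *%R (linform u) (@linform_is_scalar m u).

Lemma linformBl m (u v : 'cV[R]_m) x :
  linform (u - v) x = linform u x - linform v x.
Proof. by rewrite /linform mulmxBr !mxE. Qed.

Lemma linformZl m (u : 'cV[R]_m) a x : linform (a *: u) x = a * linform u x.
Proof. by rewrite /linform -scalemxAr mxE. Qed.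

Lemma linform_mulmx m p (u : 'cV[R]_m) (A : 'M_(p, m)) y :
  linform u (y *m A) = linform (A *m u) y.
Proof. by rewrite /linform mulmxA. Qed.

Lemma linform_delta m i (x : 'rV[R]_m) : linform (delta_mx i 0) x = x 0 i.
Proof. by rewrite /linform -colE mxE. Qed.

Definition affine_map p m (A : 'M[R]_(p, m)) (b : 'rV[R]_m) (y : 'rV[R]_p) :=
  b + y *m A.

(* The bound is strict, so that [degree_lt 0 f] says that [f] vanishes. *)
Inductive degree_lt m : nat -> ('rV[R]_m -> R) -> Prop :=
| degree_lt_zero n : degree_lt n (fun=> 0)
| degree_lt_const n a : degree_lt n.+1 (fun=> a)
| degree_ltD n f g :
    degree_lt n f -> degree_lt n g -> degree_lt n (fun x => f x + g x)
| degree_lt_affineM n a u f :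
    degree_lt n f -> degree_lt n.+1 (fun x => (a + linform u x) * f x)
| eq_degree_lt n f g : f =1 g -> degree_lt n f -> degree_lt n g.

Lemma degree_lt0 m (f : 'rV[R]_m -> R) : degree_lt 0 f -> f =1 (fun=> 0).
Proof.
suff vanish n : degree_lt n f -> n = 0%N -> f =1 (fun=> 0).
  by move/vanish; apply.
elim=> {n f} // [n f g _ IHf _ IHg|n f g fg _ IHf] n0 x.
  by rewrite (IHf n0) (IHg n0) addr0.
by rewrite -fg IHf.
Qed.

Lemma degree_lt_leq m n p (f : 'rV[R]_m -> R) :
  (n <= p)%N -> degree_lt n f -> degree_lt p f.
Proof.
move=> np fn; elim: fn p np => {n f}
  [n|n a|n f g _ IHf _ IHg|n a u f _ IHf|n f g fg _ IHf] p np.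
- exact: degree_lt_zero.
- by case: p np => // p _; apply: degree_lt_const.
- exact: degree_ltD (IHf _ np) (IHg _ np).
- by case: p np => // p np; apply: degree_lt_affineM (IHf _ np).
- exact: eq_degree_lt fg (IHf _ np).
Qed.

Lemma degree_ltZ m n a (f : 'rV[R]_m -> R) :
  degree_lt n f -> degree_lt n (fun x => a * f x).
Proof.
elim=> {n f} [n|n b|n f g _ IHf _ IHg|n b u f _ IHf|n f g fg _ IHf].
- by apply: eq_degree_lt (degree_lt_zero _ _) => x; rewrite mulr0.
- exact: degree_lt_const.
- by apply: eq_degree_lt (degree_ltD IHf IHg) => x; rewrite mulrDr.
- by apply: eq_degree_lt (degree_lt_affineM b u IHf) => x; rewrite mulrCA.
- by apply: eq_degree_lt IHf => x; rewrite fg.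
Qed.

Lemma degree_ltM m n p (f g : 'rV[R]_m -> R) :
  degree_lt n f -> degree_lt p.+1 g -> degree_lt (n + p) (fun x => f x * g x).
Proof.
move=> fn gp; elim: fn => {n f}
  [n|n a|n f f' _ IHf _ IHf'|n a u f _ IHf|n f f' ff' _ IHf].
- by apply: eq_degree_lt (degree_lt_zero _ _) => x; rewrite mul0r.
- by rewrite addSnnS; apply/degree_ltZ/(degree_lt_leq (leq_addl _ _) gp).
- by apply: eq_degree_lt (degree_ltD IHf IHf') => x; rewrite mulrDl.
- by apply: eq_degree_lt (degree_lt_affineM a u IHf) => x; rewrite mulrA.
- by apply: eq_degree_lt IHf => x; rewrite ff'.
Qed.

Lemma degree_lt_sum m n (I : Type) (r : seq I) (f : I -> 'rV[R]_m -> R) :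
  (forall i, degree_lt n (f i)) -> degree_lt n (fun x => \sum_(i <- r) f i x).
Proof.
move=> fn; elim: r => [|i r IHr].
  by apply: eq_degree_lt (degree_lt_zero _ _) => x; rewrite big_nil.
by apply: eq_degree_lt (degree_ltD (fn i) IHr) => x; rewrite big_cons.
Qed.

Lemma degree_lt_prod m (I : Type) (r : seq I) d (f : I -> 'rV[R]_m -> R) :
  (forall i, degree_lt (d i).+1 (f i)) ->
  degree_lt (\sum_(i <- r) d i).+1 (fun x => \prod_(i <- r) f i x).
Proof.
move=> fd; elim: r => [|i r IHr].
  by apply: eq_degree_lt (degree_lt_const _ _ 1) => x; rewrite big_nil.
rewrite big_cons -addSn.
by apply: eq_degree_lt (degree_ltM (fd i) IHr) => x; rewrite big_cons.
Qed.

Lemma degree_lt_coord_exp m (i : 'I_m) k :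
  degree_lt k.+1 (fun x : 'rV[R]_m => x 0 i ^+ k).
Proof.
elim: k => [|k IHk]; first exact: degree_lt_const.
apply: eq_degree_lt (degree_lt_affineM 0 (delta_mx i 0) IHk) => x.
by rewrite add0r linform_delta exprS.
Qed.

Lemma degree_lt_comp_affine m p n (A : 'M_(p, m)) b (f : 'rV[R]_m -> R) :
  degree_lt n f -> degree_lt n (f \o affine_map A b).
Proof.
elim=> {n f} [n|n a|n f g _ IHf _ IHg|n a u f _ IHf|n f g fg _ IHf].
- exact: degree_lt_zero.
- exact: degree_lt_const.
- exact: degree_ltD IHf IHg.
- apply: eq_degree_lt (degree_lt_affineM (a + linform u b) (A *m u) IHf) => y.
  by rewrite /= /affine_map linearD /= linform_mulmx addrA.
- by apply: eq_degree_lt IHf => y; apply: fg.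
Qed.

(* Moving [x] by [u(x) - l] times [w] changes every affine form, hence every
   polynomial, by a multiple of [u(x) - l]. *)
Lemma degree_lt_difference m n u w l (f : 'rV[R]_m -> R) : degree_lt n f ->
  exists2 g, degree_lt n.-1 g & forall x,
    f x - f (x - (linform u x - l) *: w) = (linform u x - l) * g x.
Proof.
elim=> {n f} [n|n a|n f f' _ [g gn gE] _ [g' g'n g'E]|n a v f fn [g gn gE]|
  n f f' ff' _ [g gn gE]].
- by exists (fun=> 0) => [|x]; [apply: degree_lt_zero|ring].
- by exists (fun=> 0) => [|x]; [apply: degree_lt_zero|ring].
- exists (fun x => g x + g' x) => [|x]; first exact: degree_ltD.
  by rewrite mulrDr -gE -g'E; ring.
- pose h x := a + linform v (x - (linform u x - l) *: w).
  exists (fun x => linform v w * f x + h x * g x) => [|x]; last first.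
    by rewrite mulrDr [_ * (h x * _)]mulrCA -gE /h linearB linearZ /=; ring.
  apply: degree_ltD; first exact: degree_ltZ.
  case: n gn {fn} => [|n] gn.
    apply: eq_degree_lt (degree_lt_zero _ _) => x.
    by rewrite (degree_lt0 gn) mulr0.
  have := degree_lt_affineM (a + l * linform v w) (v - linform v w *: u) gn.
  apply: eq_degree_lt => x; congr (_ * _).
  by rewrite /h linformBl linformZl linearB linearZ /=; ring.
- by exists g => // x; rewrite -!ff' gE.
Qed.

End Degree.

Section LinearForms.
Variable F : fieldType.

Lemma linform_eq0 m (u : 'cV[F]_m) x : (linform u x == 0) = (x <= kermx u)%MS.
Proof.
rewrite sub_kermx; apply/eqP/eqP => [ux0|xu0]; last by rewrite /linform xu0 mxE.
by rewrite [_ *m _]mx11_scalar -/(linform u x) ux0 raddf0.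
Qed.

Lemma linform_surj m (u : 'cV[F]_m) l : u != 0 -> exists w, linform u w = l.
Proof.
move=> /matrix0Pn [i [j]]; rewrite ord1 => ui_neq0.
exists ((l / u i 0) *: delta_mx 0 i).
by rewrite linearZ /= /linform -rowE mxE divfK.
Qed.

Lemma mxrank_kermx_cV m (u : 'cV[F]_m) : u != 0 -> \rank (kermx u) = m.-1.
Proof.
move=> u0; rewrite mxrank_ker -subn1; congr (_ - _)%N.
by apply/eqP; rewrite eqn_leq rank_leq_col lt0n mxrank_eq0.
Qed.

Lemma exists_cV_annihilator m n (V : 'M[F]_(m, n)) : (\rank V < n)%N ->
  exists2 u : 'cV[F]_n, u != 0 & (V <= kermx u)%MS.
Proof.
move=> Vn; have : cokermx V != 0.
  by rewrite -mxrank_eq0 mxrank_coker subn_eq0 -ltnNge.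
case/matrix0Pn=> i [j cij]; exists (col j (cokermx V)).
  by apply/matrix0Pn; exists i, 0; rewrite mxE.
by apply/sub_kermxP; rewrite colE mulmxA mulmx_coker mul0mx.
Qed.

Lemma exists_cV_neq0 m : (0 < m)%N -> exists u : 'cV[F]_m, u != 0.
Proof.
case: m => // m _; exists (const_mx 1).
by apply/matrix0Pn; exists 0, 0; rewrite mxE oner_neq0.
Qed.

Lemma exists_cV_annihilator_add m n (V : 'M[F]_(m, n)) (w : 'rV[F]_n) :
  ((\rank V).+1 < n)%N ->
  exists u : 'cV[F]_n, [/\ u != 0, (V <= kermx u)%MS & linform u w = 0].
Proof.
move=> Vn; have [|u u0] := @exists_cV_annihilator _ _ (V + w)%MS.
  apply: leq_ltn_trans Vn; rewrite -[(\rank V).+1]addn1.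
  by rewrite (leq_trans (mxrank_adds_leqif _ _)) // leq_add2l rank_leq_row.
by rewrite addsmx_sub -linform_eq0 => /andP[Vu /eqP]; exists u.
Qed.

End LinearForms.

Section Division.
Variable F : fieldType.

Lemma degree_lt_divide m n u l (f : 'rV[F]_m -> F) : u != 0 -> degree_lt n f ->
  (forall x, linform u x = l -> f x = 0) ->
  exists2 g, degree_lt n.-1 g & forall x, f x = (linform u x - l) * g x.
Proof.
move=> /(linform_surj 1) [w uw] fn f0.
have [g gn fE] := degree_lt_difference u w l fn.
exists g => // x; rewrite -fE (f0 (x - _)) ?subr0 //.
by rewrite linearB linearZ /= uw; ring.
Qed.

Lemma degree_lt_divide_prod m n u (r : seq F) (f : 'rV[F]_m -> F) :
  u != 0 -> uniq r -> degree_lt n f ->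
  (forall x, linform u x \in r -> f x = 0) ->
  exists2 g, degree_lt (n - size r) g &
             forall x, f x = (\prod_(l <- r) (linform u x - l)) * g x.
Proof.
move=> u0; elim: r n f => [|l r IHr] n f /=.
  by move=> _ fn _; exists f => [|x]; rewrite ?subn0 // big_nil mul1r.
case/andP=> lr ur fn f0.
have [x uxl|g gn fE] := degree_lt_divide u0 fn (l := l).
  by apply: f0; rewrite uxl mem_head.
have [x uxr|h hn gE] := IHr _ _ ur gn.
  have : (linform u x - l) * g x == 0 by rewrite -fE f0 // inE uxr orbT.
  rewrite mulf_eq0 subr_eq0 => /orP[/eqP uxl|/eqP //].
  by rewrite -uxl uxr in lr.
exists h => [|x]; first by rewrite -subn1 -subnDA add1n in hn.
by rewrite fE gE big_cons mulrA.
Qed.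

End Division.

(* Let a nonzero function of degree at most [t (n - 1) + s] on an [n]-element
   field vanish on exactly [k] of [n] parallel hyperplanes of dimension [m].  On
   the other ones its degree is at most [t (n - 1) + (s - k)], which for [s < k]
   is [(t - 1) (n - 1) + (n - 1 + s - k)].  The least weight in this degree is
   [section_bound n s k * n ^ m / n ^ t.+1]. *)
Definition section_bound n s k : nat :=
  (if k <= s then n - (s - k) else n * (k.+1 - s))%N.

Lemma section_bound_leqif n s k : (s < n)%N -> (k < n)%N ->
  ((n - s) * n <= (n - k) * section_bound n s k
     ?= iff [|| k == 0%N, k == s | k == n.-1])%N.
Proof.
move=> sn kn; rewrite /section_bound; case: leqP => [ks|sk].
  have -> : ((n - k) * (n - (s - k)) = (n - s) * n + k * (s - k))%N.
    rewrite -(subnKC ks) in sn *; rewrite -(subnKC sn).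
    move: (s - k)%N (n - _)%N => d e.
    have -> : ((k + d).+1 + e - k = d.+1 + e)%N by lia.
    have -> : (k + d - k = d)%N by lia.
    have -> : ((k + d).+1 + e - d = k.+1 + e)%N by lia.
    have -> : ((k + d).+1 + e - (k + d) = e.+1)%N by lia.
    by ring.
  split; first exact: leq_addr.
  by rewrite -{1}[(_ * n)%N]addn0 eqn_add2l eq_sym muln_eq0; lia.
have -> : ((n - k) * (n * (k.+1 - s)) =
           (n - s) * n + n * (n - k).-1 * (k - s))%N.
  rewrite -(subnKC (ltnW sk)) in kn *; rewrite -(subnKC kn).
  move: (k - s)%N (n - _)%N => d e.
  have -> : ((s + d).+1 + e - (s + d) = e.+1)%N by lia.
  have -> : ((s + d).+1 - s = d.+1)%N by lia.
  have -> : ((s + d).+1 + e - s = d.+1 + e)%N by lia.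
  have -> : (s + d - s = d)%N by lia.
  by rewrite /=; ring.
split; first exact: leq_addr.
by rewrite -{1}[(_ * n)%N]addn0 eqn_add2l eq_sym !muln_eq0; lia.
Qed.

Lemma leq_card_bigcup (I T : finType) (A : I -> {set T}) :
  (#|\bigcup_i A i| <= \sum_i #|A i|)%N.
Proof.
elim/big_ind2: _ => [|n A1 p A2 le1 le2|//]; first by rewrite cards0.
by rewrite (leq_trans (leq_card_setU _ _)) // leq_add.
Qed.

Section FiniteGeometry.
Variable F : finFieldType.
Notation q := #|F|.

Lemma affine_eq m (a x : 'rV[F]_m) V :
  x \in affine a V -> affine a V = affine x V.
Proof.
rewrite inE => xaV; apply/setP => y; rewrite !inE; apply/idP/idP => yV.
  have -> : y - x = (y - a) - (x - a) by rewrite opprB addrA subrK.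
  by rewrite addmx_sub // eqmx_opp.
by rewrite -(subrK x y) -addrA addmx_sub.
Qed.

Lemma affine_setT m (a : 'rV[F]_m) : affine a 1%:M = setT.
Proof. by apply/setP => x; rewrite !inE submx1. Qed.

Definition parametrizes p m (A : 'M[F]_(p, m)) b (H : {set 'rV[F]_m}) :=
  row_free A /\ affine_map A b @: setT = H.

Lemma affine_map_inj p m (A : 'M[F]_(p, m)) b :
  row_free A -> injective (affine_map A b).
Proof. by move=> freeA x y /addrI; apply: row_free_inj. Qed.

Lemma imset_affine p m (A : 'M[F]_(p, m)) b c (V : 'M_p) :
  affine_map A b @: affine c V = affine (affine_map A b c) <<V *m A>>%MS.
Proof.
apply/setP => x; rewrite inE genmxE; apply/imsetP/idP => [[y]|/submxP[z xE]].
  rewrite inE => yV ->; rewrite /affine_map opprD addrACA subrr add0r -mulmxBl.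
  exact: submxMr.
exists (c + z *m V); first by rewrite inE addrAC subrr add0r submxMl.
by rewrite /affine_map mulmxDl -mulmxA -xE addrA addrC subrK.
Qed.

Lemma affine_parametrized p m b (V : 'M[F]_m) : \rank V = p ->
  exists A : 'M_(p, m), parametrizes A b (affine b V).
Proof.
move=> <-; exists (row_base V); split; first exact: row_base_free.
rewrite -(affine_setT 0) imset_affine /affine_map mul0mx addr0; apply/setP => x.
by rewrite !inE genmxE mul1mx eq_row_base.
Qed.

Lemma card_parametrized p m (A : 'M[F]_(p, m)) b H : parametrizes A b H ->
  #|H| = (q ^ p)%N.
Proof.
case=> freeA <-; rewrite card_imset; last exact: affine_map_inj.
by rewrite cardsT card_mx mul1n.
Qed.

Lemma card_affine m (a : 'rV[F]_m) V : #|affine a V| = (q ^ \rank V)%N.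
Proof.
by have [A /card_parametrized] := affine_parametrized a (erefl (\rank V)).
Qed.

Definition hyperplane m (u : 'cV[F]_m) (l : F) : {set 'rV[F]_m} :=
  [set x | linform u x == l].

Lemma affine_kermx m (u : 'cV[F]_m) a :
  affine a (kermx u) = hyperplane u (linform u a).
Proof. by apply/setP => x; rewrite !inE -linform_eq0 linearB subr_eq0. Qed.

Lemma affine_sub_hyperplane m (u : 'cV[F]_m) a V :
  (V <= kermx u)%MS -> affine a V \subset hyperplane u (linform u a).
Proof.
move=> Vu; rewrite -affine_kermx; apply/subsetP => x; rewrite !inE => xV.
exact: submx_trans Vu.
Qed.

Lemma hyperplane_parametrized m (u : 'cV[F]_m) l : u != 0 ->
  exists (A : 'M_(m.-1, m)) b, parametrizes A b (hyperplane u l).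
Proof.
move=> u0; have [b <-] := linform_surj l u0.
have [A] := affine_parametrized b (mxrank_kermx_cV u0).
by rewrite affine_kermx => Ab; exists A, b.
Qed.

Lemma linform_affine_map p m (u : 'cV[F]_m) l (A : 'M_(p, m)) b y :
  parametrizes A b (hyperplane u l) -> linform u (affine_map A b y) = l.
Proof.
case=> _ /setP/(_ (affine_map A b y)).
by rewrite imset_f // inE => /esym/eqP.
Qed.

Lemma card_hyperplane_sections m (u : 'cV[F]_m) (S : {set 'rV[F]_m}) :
  #|S| = (\sum_(l in linform u @: S) #|S :&: hyperplane u l|)%N.
Proof.
rewrite -sum1_card (partition_big_imset (linform u)); apply: eq_bigr => l _.
by rewrite -sum1_card; apply: eq_bigl => x; rewrite !inE.
Qed.

Lemma mem_imset_linform m (u : 'cV[F]_m) (S : {set 'rV[F]_m}) l :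
  (l \in linform u @: S) = (S :&: hyperplane u l != set0).
Proof.
apply/imsetP/set0Pn => [[x xS ->]|[x]]; first by exists x; rewrite !inE xS eqxx.
by rewrite !inE => /andP[xS /eqP <-]; exists x.
Qed.

Lemma imset_supp_affine_map p m (A : 'M[F]_(p, m)) b f H : parametrizes A b H ->
  affine_map A b @: supp (f \o affine_map A b) = supp f :&: H.
Proof.
case=> _ <-; apply/setP => x; apply/imsetP/setIP => [[y]|[xf /imsetP[y _ xE]]].
  by rewrite inE => yf ->; rewrite imset_f // inE.
by exists y; rewrite // inE /= -xE; rewrite inE in xf.
Qed.

Lemma weight_affine_map p m (A : 'M[F]_(p, m)) b f H : parametrizes A b H ->
  weight (f \o affine_map A b) = #|supp f :&: H|.
Proof.
move=> pA; rewrite -(imset_supp_affine_map f pA) card_imset //.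
by apply: affine_map_inj pA.1.
Qed.

Lemma supp_affine_map_neq0 p m (A : 'M[F]_(p, m)) b u f l :
  parametrizes A b (hyperplane u l) -> l \in linform u @: supp f ->
  supp (f \o affine_map A b) != set0.
Proof.
by move=> pA; rewrite mem_imset_linform -(imset_supp_affine_map f pA) imset_eq0.
Qed.

Lemma degree_lt_hyperplane_section p m n u l (A : 'M[F]_(p, m)) b f : u != 0 ->
  parametrizes A b (hyperplane u l) -> degree_lt n f ->
  degree_lt (n - (q - #|linform u @: supp f|)) (f \o affine_map A b).
Proof.
move=> u0 pA fn; set K := linform u @: _.
have [x|g gn fE] := degree_lt_divide_prod u0 (enum_uniq (~: K)) fn.
  rewrite mem_enum inE; apply: contraNeq => fx.
  by rewrite imset_f // inE.
rewrite -cardE -[#|~: _|](addKn #|K|) cardsC in gn.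
apply: eq_degree_lt (degree_ltZ (\prod_(k <- enum (~: K)) (l - k))
  (degree_lt_comp_affine A b gn)) => y.
by rewrite /= fE (linform_affine_map _ pA).
Qed.

Lemma exists_hyperplane_through m (V : 'M[F]_m) a x : ((\rank V).+1 < m)%N ->
  exists u l, [/\ u != 0, affine a V \subset hyperplane u l &
                  x \in hyperplane u l].
Proof.
move=> /(exists_cV_annihilator_add (x - a)) [u [u0 Vu /eqP]].
rewrite linearB subr_eq0 => ux; exists u, (linform u a).
by rewrite affine_sub_hyperplane // inE.
Qed.

(* A hyperplane meeting [S] most often contains it: otherwise a hyperplane
   through the section and one more point of [S] would meet [S] more often. *)
Lemma sub_hyperplane_of_flat_sections m (S : {set 'rV[F]_m}) : (0 < m)%N ->
  (forall u l, u != 0 -> exists a (V : 'M_m),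
     ((\rank V).+1 < m)%N /\ S :&: hyperplane u l \subset affine a V) ->
  exists u l, u != 0 /\ S \subset hyperplane u l.
Proof.
move=> m0 flat; have [e e0] := exists_cV_neq0 F m0.
pose incidence (h : 'cV[F]_m * F) := #|S :&: hyperplane h.1 h.2|.
have := @arg_maxnP _ (e, 0) (fun h => h.1 != 0) incidence e0.
case=> -[u l] /= u0 max_ul.
exists u, l; split=> //; apply/subsetP => x xS; apply: contraTT isT => xH.
have [a [V [Vm SV]]] := flat u l u0.
have [v [k [v0 Vv xv]]] := exists_hyperplane_through a x Vm.
have := max_ul (v, k) v0; rewrite leqNgt => /negP[].
apply/proper_card/properP; split.
  by rewrite subsetI subsetIl (subset_trans SV).
by exists x; rewrite in_setI ?(negbTE xH) ?andbF // xS.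
Qed.

Definition pencil m (u v : 'cV[F]_m) (k : option F) : 'cV[F]_m :=
  if k is Some c then v - c *: u else u.

Lemma exists_pencil_through m (V : 'M[F]_m) : ((\rank V).+1 < m)%N ->
  exists u v : 'cV[F]_m,
    forall k, pencil u v k != 0 /\ (V <= kermx (pencil u v k))%MS.
Proof.
move=> Vm; have [u u0 Vu] := exists_cV_annihilator (ltnW Vm).
have [w uw] := linform_surj 1 u0.
have [v [v0 Vv vw]] := exists_cV_annihilator_add w Vm.
exists u, v => -[c|] //=; split; last first.
  apply/sub_kermxP; rewrite mulmxBr -scalemxAr.
  by rewrite (sub_kermxP Vv) (sub_kermxP Vu) scaler0 subr0.
apply: contraNneq v0 => /subr0_eq vE.
by rewrite vE linformZl uw mulr1 in vw; rewrite vE vw scale0r.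
Qed.

Lemma pencil_cover m (u v : 'cV[F]_m) a x :
  exists k, x \in hyperplane (pencil u v k) (linform (pencil u v k) a).
Proof.
have [ux|uxa] := eqVneq (linform u x) (linform u a).
  by exists None; rewrite inE ux.
exists (Some (linform v (x - a) / linform u (x - a))).
rewrite inE -subr_eq0 -linearB /= linformBl linformZl divfK ?subrr //.
by rewrite linearB subr_eq0.
Qed.

(* The [q + 1] hyperplanes of a pencil cover the space. *)
Lemma card_affine_sub_equidistributed m (S : {set 'rV[F]_m}) a (V : 'M_m) N :
  ((\rank V).+1 < m)%N -> affine a V \subset S ->
  (forall u l, u != 0 -> #|S :&: hyperplane u l| = N) ->
  (q * q ^ \rank V <= N)%N.
Proof.
move=> Vm VS SN; have [u [v uv]] := exists_pencil_through Vm.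
pose H k := hyperplane (pencil u v k) (linform (pencil u v k) a).
have VSH k : affine a V \subset S :&: H k.
  by rewrite subsetI VS affine_sub_hyperplane //; apply: (uv k).2.
have card_section k : #|(S :\: affine a V) :&: H k| = (N - q ^ \rank V)%N.
  by rewrite setIDAC cardsDS // SN ?card_affine //; apply: (uv k).1.
have cover : (#|S :\: affine a V| <= q.+1 * (N - q ^ \rank V))%N.
  have -> : (q.+1 * (N - q ^ \rank V) = \sum_k #|(S :\: affine a V) :&: H k|)%N.
    rewrite (eq_bigr _ (fun k _ => card_section k)).
    by rewrite sum_nat_const card_option.
  apply: leq_trans (subset_leq_card _) (leq_card_bigcup _).
  apply/subsetP => x xS; have [k xk] := pencil_cover u v a x.
  by apply/bigcupP; exists k; rewrite // inE xS.
have flat_le_section : (q ^ \rank V <= N)%N.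
  rewrite -(SN _ (linform u a) (uv None).1) -(card_affine a).
  by rewrite subset_leq_card ?VSH.
have cardS : #|S| = (q * N)%N.
  rewrite (card_hyperplane_sections u) (eq_bigl predT) => [|l].
    rewrite (eq_bigr _ (fun l _ => SN u l (uv None).1)) sum_nat_const.
    by rewrite cardT -cardE.
  rewrite mem_imset_linform -card_gt0 SN ?(uv None).1 //.
  by rewrite (leq_trans _ flat_le_section) // expn_gt0 ltnW ?finNzRing_gt1.
rewrite cardsDS // card_affine cardS in cover.
nia.
Qed.

Lemma card_flat_union_shape m t k (S : {set 'rV[F]_m}) :
  flat_union_shape t k S -> #|S| = (k * q ^ (m - t.+1))%N.
Proof.
case=> V [W [b [a [rV _ aN _ ->]]]].
have disj i j : i != j -> [disjoint affine (a i) V & affine (a j) V].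
  move=> /aN; apply: contraNT; rewrite -setI_eq0 => /set0Pn [x /setIP[xi xj]].
  by rewrite (affine_eq xi) (affine_eq xj).
rewrite -sum1_card (partition_disjoint_bigcup _ _ disj).
under eq_bigr do rewrite sum1_card card_affine rV.
by rewrite sum_nat_const card_ord.
Qed.

Lemma flat_union_shape_sub_affine m t k (S : {set 'rV[F]_m}) :
  flat_union_shape t k S ->
  exists b (W : 'M_m), \rank W = (m - t)%N /\ S \subset affine b W.
Proof.
case=> V [W [b [a [_ rW _ aW ->]]]].
by exists b, W; split => //; apply/bigcupsP.
Qed.

Lemma flat_union_shape_affine_sub m t k (S : {set 'rV[F]_m}) :
  flat_union_shape t k.+1 S ->
  exists a (V : 'M_m), \rank V = (m - t.+1)%N /\ affine a V \subset S.
Proof.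
case=> V [W [b [a [rV _ _ _ ->]]]].
by exists (a ord0), V; split=> //; apply: (bigcup_sup ord0).
Qed.

Lemma flat_union_shape_imset p m t k (A : 'M[F]_(p, m)) b S : row_free A ->
  flat_union_shape t k S ->
  flat_union_shape (m - p + t) k (affine_map A b @: S).
Proof.
move=> freeA [V [W [c [a [rV rW aN aW ->]]]]].
have pm : (p <= m)%N by rewrite -(eqP freeA) rank_leq_col.
exists <<V *m A>>%MS, <<W *m A>>%MS, (affine_map A b c), (affine_map A b \o a).
split.
- by rewrite genmxE mxrankMfree // rV; lia.
- by rewrite genmxE mxrankMfree // rW; lia.
- move=> i j ij; rewrite -!imset_affine; apply: contraNneq (aN _ _ ij).
  by move/(imset_inj (affine_map_inj (b := b) freeA)) ->.
- by move=> i; rewrite -!imset_affine imsetS.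
apply/setP => x; apply/imsetP/bigcupP => [[y /bigcupP [i _ yi] ->]|[i _]].
  by exists i; rewrite // -imset_affine imset_f.
rewrite -imset_affine => /imsetP [y yi ->].
by exists y => //; apply/bigcupP; exists i.
Qed.

Lemma flat_union_shape_hyperplanes m (u : 'cV[F]_m) (K : {set F}) : u != 0 ->
  flat_union_shape 0 #|K| (linform u @^-1: K).
Proof.
move=> u0; have [w uw] := linform_surj 1 u0.
have affineE l : affine (l *: w) (kermx u) = hyperplane u l.
  by rewrite affine_kermx linearZ /= uw mulr1.
exists (kermx u), 1%:M, 0, (fun i => enum_val i *: w); split.
- by rewrite mxrank_kermx_cV // subn1.
- by rewrite mxrank1 subn0.
- move=> i j; apply: contraNneq => /setP /(_ (enum_val i *: w)).
  rewrite !affineE !inE linearZ /= uw mulr1 eqxx.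
  by move=> /esym/eqP/enum_val_inj ->.
- by move=> i; rewrite affine_setT subsetT.
apply/setP => x; rewrite inE; apply/idP/bigcupP => [xK|[i _]].
  exists (enum_rank_in xK (linform u x)) => //.
  by rewrite affineE inE enum_rankK_in.
by rewrite affineE inE => /eqP ->; apply: enum_valP.
Qed.

End FiniteGeometry.

Section ReedMuller.
Variable F : finFieldType.
Notation q := #|F|.

Let q_gt1 : (1 < q)%N. Proof. exact: finNzRing_gt1. Qed.
Let q_gt0 : (0 < q)%N. Proof. exact: ltnW. Qed.
Let expq_gt0 m : (0 < q ^ m)%N. Proof. by rewrite expn_gt0 q_gt0. Qed.

Lemma degree_lt_monom m (e : expvec F m) :
  degree_lt (\sum_(i < m) (e i : nat)).+1 (monom e).
Proof.
apply: (degree_lt_prod _ (d := fun i => e i : nat)) => i.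
exact: degree_lt_coord_exp.
Qed.

Lemma in_RM_degree_lt m r (f : 'rV[F]_m -> F) : in_RM r f -> degree_lt r.+1 f.
Proof.
case=> c [c_deg fE].
suff fr : degree_lt r.+1 (fun x => \sum_e c e * monom e x).
  by apply: eq_degree_lt fr => x; rewrite fE.
apply: degree_lt_sum => e; have [->|ce0] := eqVneq (c e) 0.
  by apply: eq_degree_lt (degree_lt_zero _ _ _) => x; rewrite mul0r.
by apply/degree_ltZ/(degree_lt_leq _ (degree_lt_monom e)); rewrite ltnS c_deg.
Qed.

Lemma degree_lt0_supp m (f : 'rV[F]_m -> F) : degree_lt 0 f -> supp f = set0.
Proof. by move=> f0; apply/setP => x; rewrite !inE (degree_lt0 f0) eqxx. Qed.

Lemma weight_gt0 m (f : 'rV[F]_m -> F) : (0 < weight f)%N = (supp f != set0).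
Proof. exact: card_gt0. Qed.

Lemma card_imset_linform_bounds m u (f : 'rV[F]_m -> F) : supp f != set0 ->
  (0 < #|linform u @: supp f| <= q)%N.
Proof. by move=> f0; rewrite card_gt0 imset_eq0 f0 max_card. Qed.

(* Multiplying by [q ^ t.+1] avoids the exponent [m - t - 1], which is negative
   for [m <= t]. *)
Definition min_weight_bound m := forall t s (f : 'rV[F]_m -> F), (s < q)%N ->
  degree_lt (t * (q - 1) + s).+1 f -> supp f != set0 ->
  ((q - s) * q ^ m <= q ^ t.+1 * weight f)%N.

Lemma weight_section_ge m t s (f : 'rV[F]_m.+1 -> F) (u : 'cV_m.+1) l
    (K := linform u @: supp f) :
  min_weight_bound m -> u != 0 -> (s < q)%N ->
  degree_lt (t * (q - 1) + s).+1 f -> l \in K ->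
  (section_bound q s (q - #|K|) * q ^ m
     <= q ^ t.+1 * #|supp f :&: hyperplane u l|)%N.
Proof.
move=> bound u0 sq fn lK; have [A [b pA]] := hyperplane_parametrized l u0.
have g0 := supp_affine_map_neq0 pA lK.
have := degree_lt_hyperplane_section u0 pA fn; rewrite -/K.
have : (q - #|K| < q)%N by rewrite ltn_subrL (cardD1 l) lK q_gt0.
rewrite -(weight_affine_map f pA) /section_bound; move: (q - #|K|)%N => k kq gn.
case: (leqP k s) => [ks|sk].
  apply: bound => //; first by rewrite (leq_ltn_trans (leq_subr _ _)).
  by move: (t * _)%N gn => d /degree_lt_leq; apply; lia.
case: t fn gn => [|t] fn gn.
  by rewrite degree_lt0_supp ?eqxx // in g0; apply: degree_lt_leq gn; lia.
have -> : (k.+1 - s = q - (q - 1 + s - k))%N by lia.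
rewrite expnS -!mulnA leq_mul2l; apply/orP; right.
apply: bound => //; first lia.
by rewrite mulSn in gn; move: (t * _)%N gn => d /degree_lt_leq; apply; lia.
Qed.

Lemma section_bound_leqif_weight m t s (f : 'rV[F]_m.+1 -> F) (u : 'cV_m.+1)
    (K := linform u @: supp f) :
  min_weight_bound m -> u != 0 -> (s < q)%N ->
  degree_lt (t * (q - 1) + s).+1 f ->
  (#|K| * section_bound q s (q - #|K|) * q ^ m <= q ^ t.+1 * weight f
     ?= iff [forall l in K, section_bound q s (q - #|K|) * q ^ m ==
                            q ^ t.+1 * #|supp f :&: hyperplane u l|])%N.
Proof.
move=> bound u0 sq fn.
rewrite /weight (card_hyperplane_sections u) -/K big_distrr /=.
rewrite -mulnA -sum_nat_const; apply: leqif_sum => l lK.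
by apply/leqif_eq/weight_section_ge.
Qed.

Lemma min_weight_bound_holds m : min_weight_bound m.
Proof.
elim: m => [|m IHm] t s f sq fn f0.
  rewrite expn0 muln1 (leq_trans (leq_subr _ _)) // expnS -mulnA leq_pmulr //.
  by rewrite muln_gt0 expq_gt0 weight_gt0.
have [u u0] := exists_cV_neq0 F (ltn0Sn m).
have /andP[K0 Kq] := card_imset_linform_bounds u f0.
apply: leq_trans (section_bound_leqif_weight IHm u0 sq fn).
rewrite expnS mulnA leq_mul2r; apply/orP; right.
set k := #|_| in K0 Kq *; rewrite -{1}(subKn Kq).
by apply: section_bound_leqif; rewrite ?ltn_subrL ?K0.
Qed.

Definition min_weight_word m t s (f : 'rV[F]_m -> F) :=
  [/\ degree_lt (t * (q - 1) + s).+1 f, supp f != set0 &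
      (q ^ t.+1 * weight f = (q - s) * q ^ m)%N].

Lemma min_weight_sections m t s (f : 'rV[F]_m.+1 -> F) (u : 'cV_m.+1)
    (K := linform u @: supp f) (k := (q - #|K|)%N) :
  u != 0 -> (s < q)%N -> min_weight_word t s f ->
  [|| k == 0%N, k == s | k == q.-1] /\
  {in K, forall l, q ^ t.+1 * #|supp f :&: hyperplane u l| =
                   section_bound q s k * q ^ m}%N.
Proof.
move=> u0 sq [fn f0 fw].
have /andP[K0 Kq] := card_imset_linform_bounds u f0.
have kq : (k < q)%N by rewrite ltn_subrL K0.
have bound := section_bound_leqif sq kq.
have total := section_bound_leqif_weight (@min_weight_bound_holds m) u0 sq fn.
rewrite -/K -/k -{1}(subKn Kq) fw expnS mulnA in total.
have boundE : ((q - k) * section_bound q s k = (q - s) * q)%N.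
  apply/eqP; rewrite eqn_leq bound andbT -(leq_pmul2r (expq_gt0 m)).
  exact: total.
split; first by rewrite -bound boundE.
by move: total.2; rewrite boundE eqxx => /esym/forall_inP eqK l /eqK/eqP.
Qed.

Lemma min_weight_section m t s (f : 'rV[F]_m.+1 -> F) (u : 'cV_m.+1) l
    (A : 'M_(m, m.+1)) b (j := #|linform u @: supp f|)
    (g := f \o affine_map A b) :
  u != 0 -> (s.+1 < q)%N -> min_weight_word t s f ->
  parametrizes A b (hyperplane u l) -> l \in linform u @: supp f ->
  [\/ [/\ j = 1, (0 < t) & min_weight_word t.-1 s g]%N,
      j = (q - s)%N /\ min_weight_word t 0 g |
      j = q /\ min_weight_word t s g].
Proof.
move=> u0 sq fmin pA lf; have [fn f0 _] := fmin.
have g0 : supp g != set0 := supp_affine_map_neq0 pA lf.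
have gn : degree_lt _ g := degree_lt_hyperplane_section u0 pA fn.
have [k_cases /(_ l lf)] := min_weight_sections u0 (ltnW sq) fmin.
rewrite -(weight_affine_map f pA) -/g -/j in gn k_cases * => gw.
have /andP[j0 jq] : (0 < j <= q)%N := card_imset_linform_bounds u f0.
case/or3P: k_cases => /eqP kE; rewrite kE /section_bound in gn gw.
- rewrite subn0 in gn; constructor 3; split; first lia.
  by split; rewrite // gw subn0.
- rewrite leqnn subnn subn0 in gw; constructor 2; split; first lia.
  split; rewrite ?subn0 //.
  by move: (t * _)%N gn => d /degree_lt_leq; apply; lia.
constructor 1; have -> : j = 1%N by lia.
rewrite ifN ?prednK in gw; [|lia..].
case: t fmin fn gn gw => [|t] fmin fn gn gw.
  by rewrite degree_lt0_supp ?eqxx // in g0; apply: degree_lt_leq gn; lia.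
split=> //; split=> //.
  by rewrite mulSn in gn; move: (t * _)%N gn => d /degree_lt_leq; apply; lia.
by apply/eqP; rewrite -(eqn_pmul2l q_gt0) mulnA -expnS gw mulnA.
Qed.

Lemma min_weight_top_degree m s (f : 'rV[F]_m -> F) : (s < q)%N ->
  min_weight_word m s f -> s = 0%N /\ #|supp f| = 1%N.
Proof.
move=> sq [_ f0 /eqP]; rewrite expnS mulnAC eqn_pmul2r // => /eqP.
rewrite -weight_gt0 in f0; rewrite -/(weight f); nia.
Qed.

Lemma min_weight_degree0 m (f : 'rV[F]_m -> F) :
  min_weight_word 0 0 f -> supp f = setT.
Proof.
case=> _ _ /eqP; rewrite expn1 subn0 eqn_pmul2l // => /eqP wf.
by apply/eqP; rewrite eqEcard subsetT cardsT card_mx mul1n -wf /=.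
Qed.

Definition min_weight_shape m := forall t s (f : 'rV[F]_m -> F),
  (t < m)%N -> (s.+1 < q)%N -> min_weight_word t s f ->
  flat_union_shape t (q - s) (supp f).

Lemma min_weight_supp_sub_affine m t s (f : 'rV[F]_m -> F) :
  min_weight_shape m -> (t <= m)%N -> (s.+1 < q)%N -> min_weight_word t s f ->
  exists b (W : 'M_m), \rank W = (m - t)%N /\ supp f \subset affine b W.
Proof.
move=> shape; rewrite leq_eqVlt => /orP[/eqP->|tm] sq fmin.
  have [_ /eqP/cards1P [b ->]] := min_weight_top_degree (ltnW sq) fmin.
  by exists b, 0; rewrite mxrank0 subnn sub1set inE subrr sub0mx.
exact: flat_union_shape_sub_affine (shape _ _ _ tm sq fmin).
Qed.

Lemma min_weight_supp_sub_hyperplane m t s (f : 'rV[F]_m.+1 -> F) :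
  min_weight_shape m -> (0 < t <= m)%N -> (s.+1 < q)%N ->
  min_weight_word t s f ->
  exists u l, u != 0 /\ supp f \subset hyperplane u l.
Proof.
move=> shape /andP[t0 tm] sq fmin.
have [/existsP [u /andP[u0 /cards1P [l fl]]]|many] := boolP
    [exists u : 'cV[F]_m.+1, (u != 0) && (#|linform u @: supp f| == 1%N)].
  exists u, l; split=> //; apply/subsetP => x xf.
  by rewrite inE -in_set1 -fl imset_f.
apply: sub_hyperplane_of_flat_sections => // u l u0.
have [lf|lf] := boolP (l \in linform u @: supp f); last first.
  exists 0, 0; rewrite mxrank0 ltnS (leq_trans t0) //; split=> //.
  by move: lf; rewrite mem_imset_linform negbK => /eqP ->; apply: sub0set.
have [A [b pA]] := hyperplane_parametrized l u0.
have [c [W [rW gW]]] : exists c (W : 'M_m),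
    \rank W = (m - t)%N /\ supp (f \o affine_map A b) \subset affine c W.
  have [[j1 _ _]|[_ gmin]|[_ gmin]] := min_weight_section u0 sq fmin pA lf.
  - by case/existsP: many; exists u; rewrite u0 j1 eqxx.
  - by apply: min_weight_supp_sub_affine gmin => //; apply: leq_ltn_trans sq.
  - exact: min_weight_supp_sub_affine gmin.
exists (affine_map A b c), <<W *m A>>%MS.
rewrite genmxE mxrankMfree ?pA.1 // rW -imset_affine.
by rewrite -(imset_supp_affine_map f pA) imsetS // ltnS; split=> //; lia.
Qed.

Lemma min_weight_imset_linform m s (f : 'rV[F]_m.+1 -> F) (u : 'cV_m.+1)
    (K := linform u @: supp f) :
  u != 0 -> (s.+1 < q)%N -> min_weight_word 0 s f ->
  #|K| = (q - s)%N \/ K = setT.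
Proof.
move=> u0 sq fmin; have [_ /set0Pn [x xf] _] := fmin.
have [A [b pA]] := hyperplane_parametrized (linform u x) u0.
have [[//]|[]|[cardK _]] := min_weight_section u0 sq fmin pA (imset_f _ xf).
  by left.
by right; apply/eqP; rewrite eqEcard subsetT cardsT -cardK leqnn.
Qed.

Lemma min_weight_supp_preimset m s (f : 'rV[F]_m.+1 -> F) (u : 'cV_m.+1)
    (K := linform u @: supp f) :
  u != 0 -> (s.+1 < q)%N -> min_weight_word 0 s f -> #|K| = (q - s)%N ->
  supp f = linform u @^-1: K.
Proof.
move=> u0 sq fmin cardK; apply/eqP; rewrite eqEsubset -sub_imset_pre subxx /=.
apply/subsetP => x; rewrite inE => xK.
have [A [b pA]] := hyperplane_parametrized (linform u x) u0.
have gmin : min_weight_word 0 0 (f \o affine_map A b).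
  have [[//]|[_ //]|[]] := min_weight_section u0 sq fmin pA xK.
  by rewrite cardK => qs; have -> : s = 0%N by lia.
suff /subsetP/(_ x) : hyperplane u (linform u x) \subset supp f.
  by apply; rewrite inE.
apply/setIidPr; rewrite -(imset_supp_affine_map f pA).
by rewrite (min_weight_degree0 gmin) pA.2.
Qed.

Lemma min_weight_full_section m s (f : 'rV[F]_m.+1 -> F) (u : 'cV_m.+1) l
    (A : 'M_(m, m.+1)) b :
  u != 0 -> (0 < s)%N -> (s.+1 < q)%N -> min_weight_word 0 s f ->
  linform u @: supp f = setT -> parametrizes A b (hyperplane u l) ->
  min_weight_word 0 s (f \o affine_map A b).
Proof.
move=> u0 s0 sq fmin full pA.
have lf : l \in linform u @: supp f by rewrite full inE.
have cardK : #|linform u @: supp f| = q by rewrite full cardsT.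
have [[//]|[]|[//]] := min_weight_section u0 sq fmin pA lf.
by rewrite cardK; lia.
Qed.

(* Otherwise every hyperplane would meet the support in the same number of
   points, but by the shape of a section the support contains a flat of
   codimension 2. *)
Lemma exists_section_not_min_weight m s (f : 'rV[F]_m.+1 -> F) :
  min_weight_shape m -> (0 < s)%N -> (s.+1 < q)%N ->
  ~ (forall (u : 'cV_m.+1) l (A : 'M_(m, m.+1)) b,
       u != 0 -> parametrizes A b (hyperplane u l) ->
       min_weight_word 0 s (f \o affine_map A b)).
Proof.
move=> shape s0 sq sections; have [u u0] := exists_cV_neq0 F (ltn0Sn m).
have [A [b pA]] := hyperplane_parametrized 0 u0.
have gmin := sections u 0 A b u0 pA.
case: m => [|m] in f shape sections u u0 A b pA gmin *.
  by have [] := min_weight_top_degree (ltnW sq) gmin; lia.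
have gshape := shape _ _ _ (ltn0Sn m) sq gmin.
have qsE : (q - s = (q - s).-1.+1)%N by lia.
have [a [V [rV Vg]]] : exists a (V : 'M_m.+1),
    \rank V = m /\ affine a V \subset supp (f \o affine_map A b).
  rewrite qsE in gshape.
  by have := flat_union_shape_affine_sub gshape; rewrite subn1.
have Vf : affine (affine_map A b a) <<V *m A>>%MS \subset supp f.
  rewrite -imset_affine (subset_trans (imsetS _ Vg)) //.
  by rewrite (imset_supp_affine_map f pA) subsetIl.
have card_section v l :
    v != 0 -> #|supp f :&: hyperplane v l| = ((q - s) * q ^ m)%N.
  move=> v0; have [A' [b' pA']] := hyperplane_parametrized l v0.
  have [_ _ /eqP] := sections _ _ _ _ v0 pA'.
  rewrite (weight_affine_map f pA').
  by rewrite expn1 expnS mulnCA eqn_pmul2l // => /eqP.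
have := card_affine_sub_equidistributed _ Vf card_section.
rewrite genmxE mxrankMfree ?pA.1 // rV => /(_ (ltnSn _)).
by rewrite leq_pmul2r //; lia.
Qed.

Lemma exists_imset_linform_neqT m s (f : 'rV[F]_m.+1 -> F) :
  min_weight_shape m -> (0 < s)%N -> (s.+1 < q)%N -> min_weight_word 0 s f ->
  exists2 u : 'cV[F]_m.+1, u != 0 & linform u @: supp f != setT.
Proof.
move=> shape s0 sq fmin.
have [/existsP [u /andP[u0 uT]]|none] := boolP
    [exists u : 'cV[F]_m.+1, (u != 0) && (linform u @: supp f != setT)].
  by exists u.
case: (exists_section_not_min_weight shape s0 sq (f := f)) => u l A b u0.
apply: min_weight_full_section => //; apply/eqP; apply: contraNT none => uT.
by apply/existsP; exists u; rewrite u0.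
Qed.

Lemma min_weight_shape_t0 m s (f : 'rV[F]_m.+1 -> F) : min_weight_shape m ->
  (s.+1 < q)%N -> min_weight_word 0 s f -> flat_union_shape 0 (q - s) (supp f).
Proof.
move=> shape sq fmin.
suff [u u0 cardK] : exists2 u : 'cV[F]_m.+1,
    u != 0 & #|linform u @: supp f| = (q - s)%N.
  rewrite (min_weight_supp_preimset u0 sq fmin cardK) -cardK.
  exact: flat_union_shape_hyperplanes.
case: (posnP s) => [s_eq0|s0].
  have [u u0] := exists_cV_neq0 F (ltn0Sn m).
  exists u => //; have [//|->] := min_weight_imset_linform u0 sq fmin.
  by rewrite cardsT s_eq0 subn0.
have [u u0 /eqP uT] := exists_imset_linform_neqT shape s0 sq fmin.
by exists u => //; case: (min_weight_imset_linform u0 sq fmin).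
Qed.

Lemma min_weight_shape_holds m : min_weight_shape m.
Proof.
elim: m => // m IHm [|t] s f tm sq fmin; first exact: min_weight_shape_t0.
have [|u [l [u0 fH]]] := min_weight_supp_sub_hyperplane IHm _ sq fmin.
  by rewrite ltn0Sn.
have [_ f0 _] := fmin.
have imE : linform u @: supp f = [set l].
  apply/eqP; rewrite eqEsubset sub1set mem_imset_linform (setIidPl fH) f0 andbT.
  rewrite sub_imset_pre (subset_trans fH) //.
  by apply/subsetP => x; rewrite !inE.
have [A [b pA]] := hyperplane_parametrized l u0.
have gmin : min_weight_word t s (f \o affine_map A b).
  have := min_weight_section u0 sq fmin pA; rewrite imE set11 cards1.
  by case=> // [[]|[]|[]] //; lia.
rewrite -(setIidPl fH) -(imset_supp_affine_map f pA).
have := flat_union_shape_imset b pA.1 (IHm _ _ _ tm sq gmin).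
by rewrite subSnn.
Qed.

End ReedMuller.

Theorem theorem1 (F : finFieldType) (m t s r : nat) (f : 'rV[F]_m -> F) :
  (1 <= m)%N -> (s <= #|F| - 2)%N -> r = (t * (#|F| - 1) + s)%N ->
  (r < m * (#|F| - 1))%N ->
  in_RM r f -> (exists x, f x != 0) ->
  (weight f = ((#|F| - s) * #|F| ^ (m - t - 1))%N <->
   flat_union_shape t (#|F| - s) (supp f)).
Proof.
move=> _ sq rE rm fr [x fx]; have q_gt1 : (1 < #|F|)%N := finNzRing_gt1 F.
have tm : (t < m)%N.
  rewrite -(ltn_pmul2r (m := #|F| - 1)); last by rewrite subn_gt0.
  by apply: leq_ltn_trans rm; rewrite rE leq_addr.
rewrite -subnDA addn1; split=> [fw|/card_flat_union_shape //].
apply: min_weight_shape_holds => //; first by lia.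
split; first by rewrite -rE; apply: in_RM_degree_lt.
  by apply/set0Pn; exists x; rewrite inE.
by rewrite fw mulnCA -expnD subnKC.
Qed.
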